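(* Let $G$ be a $J$-colourable graph. Then its crib graph $c(G)$ is also $J$-colourable, and $\mathscr{J}(c(G))=\mathscr{J}(G)+1$.
   Context: All graphs are finite, simple, connected and undirected. Crib graph: for a graph $G$ with $V(G)=\{v_1,\ldots,v_n\}$, $c(G)$ is the graph with vertex set $\{v_1,\ldots,v_n,u_1,\ldots,u_n,w\}$ whose edges are exactly the following: $v_iv_j\in E(c(G))\iff v_iv_j\in E(G)$; $v_iu_j\in E(c(G))\iff v_iv_j\in E(G)$; and $v_iw,\,u_iw\in E(c(G))$ for all $i=1,\ldots,n$. Rainbow neighbourhoods: given a proper colouring $\mathcal{C}$ of a graph $H$ (every colour being used), a vertex $v$ belongs to a rainbow neighbourhood of $H$ with respect to $\mathcal{C}$ if its closed neighbourhood $N[v]$ contains at least one vertex of every colour class of $\mathcal{C}$. $J$-colouring: a $J$-colouring of $H$ is a proper colouring of $H$ with the maximal number of colours such that every vertex of $H$ belongs to a rainbow neighbourhood of $H$. $H$ is $J$-colourable if it has such a colouring, and then the $J$-colouring number $\mathscr{J}(H)$ is the number of colours in a $J$-colouring of $H$. *)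

(* Defs.v *)
From mathcomp Require Import all_boot.

Set Implicit Arguments.
Unset Strict Implicit.
Unset Printing Implicit Defensive.

Record graph := Graph {
  vertex :> finType;
  adj : rel vertex;
  adj_sym : symmetric adj;
  adj_irrefl : irreflexive adj;
  adj_connected : forall x y : vertex, connect adj x y
}.

Section Crib.
Variable G : graph.

(* The original vertices v_i are [Some (inl i)], their copies u_i are
   [Some (inr i)], and w is [None]. *)
Definition crib_vertex : finType := option (G + G)%type.

Definition crib_adj : rel crib_vertex := fun x y =>
  match x, y with
  | Some (inl i), Some (inl j) => adj i j
  | Some (inl i), Some (inr j) => adj i j
  | Some (inr i), Some (inl j) => adj i j
  | Some (inr _), Some (inr _) => false
  | Some _, None | None, Some _ => true
  | None, None => false
  end.

Lemma crib_adj_sym : symmetric crib_adj.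
Proof. by case=> [[i|i]|] [[j|j]|] //=; rewrite adj_sym. Qed.

Lemma crib_adj_irrefl : irreflexive crib_adj.
Proof. by case=> [[i|i]|] //=; rewrite adj_irrefl. Qed.

Lemma crib_adj_connected (x y : crib_vertex) : connect crib_adj x y.
Proof.
have toW (z : crib_vertex) : connect crib_adj z None.
  by case: z => [a|]; [apply: connect1; case: a | apply: connect0].
apply: connect_trans (toW x) _.
by rewrite (sym_connect_sym crib_adj_sym).
Qed.

Definition crib : graph :=
  Graph crib_adj_sym crib_adj_irrefl crib_adj_connected.

End Crib.

Section Colouring.
Variable H : graph.

Definition closed_nbhd (v : H) : {set H} := [set u | (u == v) || adj v u].

Section FixedNumberOfColours.
Variables (k : nat) (c : {ffun H -> 'I_k}).

Definition proper_colouring : bool :=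
  [forall x, forall y, adj x y ==> (c x != c y)].

Definition every_colour_used : bool := [forall i, exists x, c x == i].

Definition in_rainbow_nbhd (v : H) : bool :=
  [forall i, exists u in closed_nbhd v, c u == i].

Definition rainbow_colouring : bool :=
  [&& proper_colouring, every_colour_used & [forall v, in_rainbow_nbhd v]].

End FixedNumberOfColours.

Definition J_colouring (k : nat) (c : {ffun H -> 'I_k}) : Prop :=
  rainbow_colouring c /\
  forall (k' : nat) (c' : {ffun H -> 'I_k'}), rainbow_colouring c' -> k' <= k.

Definition J_colourable : Prop :=
  exists (k : nat) (c : {ffun H -> 'I_k}), J_colouring c.

(* Made total by the bound k <= #|H|, valid as every colour is used; it is 0
   when H is not J-colourable.  [J_numberP] shows that it is the number of
   colours of any J-colouring. *)
Definition J_number : nat :=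
  \max_(k < #|H|.+1 | [exists c : {ffun H -> 'I_k}, rainbow_colouring c]) k.

Lemma rainbow_colouring_leq (k : nat) (c : {ffun H -> 'I_k}) :
  rainbow_colouring c -> k <= #|H|.
Proof.
case/and3P=> _ /forallP used _.
have sub : 'I_k \subset codom c.
  apply/subsetP=> i _; have /existsP[x /eqP <-] := used i.
  exact: codom_f.
rewrite -[k in k <= _]card_ord.
exact: leq_trans (subset_leq_card sub) (leq_image_card _ _).
Qed.

Lemma J_numberP (k : nat) (c : {ffun H -> 'I_k}) :
  J_colouring c -> J_number = k.
Proof.
case=> rc maxc; apply/eqP; rewrite eqn_leq; apply/andP; split.
  by apply/bigmax_leqP=> i /existsP[c' /maxc].
have ltk : k < #|H|.+1 by rewrite ltnS (rainbow_colouring_leq rc).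
apply: (@leq_bigmax_cond _ _ (fun i : 'I_#|H|.+1 => i : nat) (Ordinal ltk)).
by apply/existsP; exists c.
Qed.

End Colouring.

(* Main.v *)
Require Import Defs.
From mathcomp Require Import all_boot.

(** Call a proper colouring rainbow when it uses every colour and every closed
    neighbourhood meets every colour class.  The theorem holds because rainbow
    colourings of [G] with [k] colours exist exactly when rainbow colourings of
    [crib G] with [k + 1] colours do, and every colouring of [crib G] uses at
    least one colour, on the hub w.

    From [G] to [crib G] ([rainbow_crib_colouring]): each copy u_i repeats the
    colour of v_i, and the hub w receives a new colour.  The closed
    neighbourhood of u_i is that of v_i in [G] with v_i replaced by u_i and
    with w added, so it meets the same colours and the new one.

    From [crib G] to [G] ([rainbow_crib_restriction]): since w is adjacent to
    everything else, its colour occurs only at w.  The key fact is that u_i and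
    v_i always share their colour ([crib_copy_colour]): otherwise u_i, to have
    the colour of v_i in its closed neighbourhood, would need a neighbour v_j
    of that colour, and v_j is also a neighbour of v_i.  Hence the u_i
    contribute no colour beyond those of the v_i, the closed neighbourhood of
    u_i meets the same colours as that of v_i in [G] and that of w, and the
    restriction to the v_i is rainbow for the colours other than that of w. *)

Lemma rainbow_colouringP {H : graph} {k : nat} {c : {ffun H -> 'I_k}} :
  reflect [/\ forall x y, adj x y -> c x <> c y,
              forall i, exists x, c x = i
            & forall v i, exists2 u, (u == v) || adj v u & c u = i]
          (rainbow_colouring c).
Proof.
apply: (iffP and3P) => -[proper_c used_c rainbow_c]; split.
- by move=> x y xy; have /forallP/(_ y)/implyP/(_ xy)/eqP := forallP proper_c x.
- by move=> i; have /existsP[x /eqP] := forallP used_c i; exists x.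
- move=> v i; have /forallP/(_ i)/exists_inP[u] := forallP rainbow_c v.
  by rewrite inE => vu /eqP; exists u.
- by apply/forallP=> x; apply/forallP=> y; apply/implyP=> /proper_c/eqP.
- by apply/forallP=> i; have [x <-] := used_c i; apply/existsP; exists x.
- apply/forallP=> v; apply/forallP=> i; have [u vu <-] := rainbow_c v i.
  by apply/exists_inP; exists u; rewrite ?inE.
Qed.

Definition crib_colouring {G : graph} {k : nat} (c : {ffun G -> 'I_k}) :
    {ffun crib G -> 'I_k.+1} :=
  [ffun x : crib G => match x with
                      | Some (inl i) | Some (inr i) => lift ord0 (c i)
                      | None => ord0
                      end].

Lemma rainbow_crib_colouring (G : graph) (k : nat) (c : {ffun G -> 'I_k}) :
  rainbow_colouring c -> rainbow_colouring (crib_colouring c).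
Proof.
move=> /rainbow_colouringP[proper_c used_c rainbow_c].
have used i : exists x : crib G, crib_colouring c x = i.
  case: (unliftP ord0 i) => [j|] ->; last by exists None; rewrite ffunE.
  by have [x <-] := used_c j; exists (Some (inl x)); rewrite ffunE.
apply/rainbow_colouringP; split=> //.
- by case=> [[x|x]|] [[y|y]|] //= xy; rewrite !ffunE // => /lift_inj;
    apply: proper_c.
- case=> [a|] i; last first.
    have [x <-] := used i; exists x => //.
    by case: x => [[x|x]|].
  case: (unliftP ord0 i) => [j|] ->; last first.
    by exists None; rewrite ?ffunE //; case: a.
  case: a => x; have [y /orP[/eqP->|xy] <-] := rainbow_c x j.
  + by exists (Some (inl x)); rewrite ?eqxx ?ffunE.
  + by exists (Some (inl y)); rewrite ?ffunE //= xy orbT.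
  + by exists (Some (inr x)); rewrite ?eqxx ?ffunE.
  + by exists (Some (inl y)); rewrite ?ffunE //= xy.
Qed.

(** A neighbour of u_i among the v_j is a neighbour of v_i too, so a colour
    class that contains v_i can meet the closed neighbourhood of u_i only at
    u_i itself. *)
Lemma crib_copy_colour {G : graph} {k : nat} {c : {ffun crib G -> 'I_k}}
    (rainbow_c : rainbow_colouring c) (i : G) :
  c (Some (inr i)) = c (Some (inl i)).
Proof.
have [proper_c _ nbhd_c] := rainbow_colouringP rainbow_c.
have [[[j|j]|] ij cj] := nbhd_c (Some (inr i)) (c (Some (inl i))).
- by case: (proper_c (Some (inl i)) (Some (inl j))).
- by move: ij; rewrite /= orbF => /eqP <-.
- by case: (proper_c (Some (inl i)) None).
Qed.

Lemma rainbow_crib_restriction (G : graph) (k : nat)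
    (c : {ffun crib G -> 'I_k.+1}) :
  rainbow_colouring c -> exists d : {ffun G -> 'I_k}, rainbow_colouring d.
Proof.
move=> rainbow_c; have copy_c := crib_copy_colour rainbow_c.
have [proper_c used_c nbhd_c] := rainbow_colouringP rainbow_c.
have neq_hub (i : G) : c None != c (Some (inl i)).
  by apply/eqP; apply: proper_c.
(* Deleting the colour of w from the palette leaves k colours. *)
pose d := [ffun i : G => s2val (unlift_some (neq_hub i))].
have dE i : c (Some (inl i)) = lift (c None) (d i).
  by rewrite ffunE; case: unlift_some.
exists d; apply/rainbow_colouringP; split.
- move=> x y xy dxy; apply: (proper_c (Some (inl x)) (Some (inl y)) xy).
  by rewrite !dE dxy.
- move=> i; have [[[x|x]|]] := used_c (lift (c None) i).
  + by rewrite dE => /lift_inj; exists x.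
  + by rewrite copy_c dE => /lift_inj; exists x.
  + by move/eqP; rewrite (negPf (neq_lift _ _)).
(* The colours around v are read off at its copy, whose only neighbours
   besides w are original vertices. *)
- move=> v i; have [[[x|x]|] vx] := nbhd_c (Some (inr v)) (lift (c None) i).
  + by rewrite dE => /lift_inj; exists x => //; rewrite [adj v x]vx orbT.
  + rewrite copy_c dE => /lift_inj dx; exists x => //.
    by move: vx; rewrite /= orbF => /eqP[->]; rewrite eqxx.
  + by move/eqP; rewrite (negPf (neq_lift _ _)).
Qed.

Theorem theorem3p2 (G : graph) (hG : J_colourable G) :
  J_colourable (crib G) /\ J_number (crib G) = J_number G + 1.
Proof.
have [k [c Jc]] := hG; have [rainbow_c max_c] := Jc.
have J_crib : J_colouring (crib_colouring c).
  split=> [|k' c']; first exact: rainbow_crib_colouring.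
  case: k' c' => // k' c' /rainbow_crib_restriction[d].
  by rewrite ltnS => /max_c.
split; first by exists k.+1, (crib_colouring c).
by rewrite (J_numberP J_crib) (J_numberP Jc) addn1.
Qed.
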